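(* Let $p\in[0,1]$ be computable, let $r_p$ be a universal $p$-sparseness test, and let $\mathcal{S}_p=\{P\in\mathcal{M}(\Omega):P\preceq B_p\}$. Then $r_p$ is a universal $\mathcal{S}_p$-test: it is an $\mathcal{S}_p$-test, and every $\mathcal{S}_p$-test $t$ satisfies $t\le c\,r_p$ for some constant $c$.
   Context: $\Omega=\{0,1\}^{\mathbb{N}}$, $\mathcal{M}(\Omega)$ the probability measures on $\Omega$, $B_p$ the Bernoulli measure with parameter $p$. Coordinatewise order $\omega\le\omega'$ iff $\omega(i)\le\omega'(i)$ for all $i$. For measures $P,Q$, $P\preceq Q$ means there is a measure $R$ on $\Omega\times\Omega$ with first marginal $P$, second marginal $Q$, and $R(\{(\omega,\omega'):\omega\le\omega'\})=1$. A function $f:\Omega\to[0,\infty]$ is lower semicomputable if each $\{\omega:r<f(\omega)\}$ ($r$ rational) is a union of an enumerable family of intervals $x\Omega$, uniformly in $r$; monotone if $\omega\le\omega'$ implies $f(\omega)\le f(\omega')$. A $p$-sparseness test is a monotone lower semicomputable $f\ge0$ with $\int f\,dB_p\le1$; a universal one dominates all of them up to a multiplicative constant. For a class $\mathcal{C}$ of measures, a $\mathcal{C}$-test is a lower semicomputable $t\ge0$ on $\Omega$ with $\int t\,dP\le1$ for all $P\in\mathcal{C}$. *)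

(* Defs.v *)
From HB Require Import structures.
From mathcomp Require Import all_boot all_order all_algebra.
From mathcomp Require Import all_classical all_reals all_analysis.
From mathcomp Require Import ring lra.

Set Implicit Arguments.
Unset Strict Implicit.
Unset Printing Implicit Defensive.

Import Order.TTheory GRing.Theory Num.Theory.

Local Open Scope classical_set_scope.
Local Open Scope ring_scope.

(* Kleene's partial recursive functions of n variables. In [rf_rec] the
   recursion variable comes first: h (0, v) = f v and
   h (k + 1, v) = g (k, h (k, v), v). In [rf_mu] the searched variable comes
   first. *)
Inductive recfun : nat -> Type :=
| rf_zero n : recfun n
| rf_succ : recfun 1
| rf_proj n (i : 'I_n) : recfun n
| rf_comp m n (f : recfun m) (g : 'I_m -> recfun n) : recfun n
| rf_rec n (f : recfun n) (g : recfun n.+2) : recfun n.+1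
| rf_mu n (f : recfun n.+1) : recfun n.

(* [computes f v y]: f is defined at v, with value y. *)
Fixpoint computes n (f : recfun n) : n.-tuple nat -> nat -> Prop :=
  match f in recfun n return n.-tuple nat -> nat -> Prop with
  | rf_zero _ => fun _ y => y = 0%N
  | rf_succ => fun v y => y = (thead v).+1
  | rf_proj _ i => fun v y => y = tnth v i
  | rf_comp m _ f g => fun v y =>
      exists2 w : m.-tuple nat,
        (forall i, computes (g i) v (tnth w i)) & computes f w y
  | rf_rec _ f g => fun v y =>
      exists s : nat -> nat,
        [/\ computes f (behead_tuple v) (s 0%N),
            forall k, (k < thead v)%N ->
              computes g [tuple of k :: s k :: behead_tuple v] (s k.+1)
          & y = s (thead v)]
  | rf_mu _ f => fun v y =>
      computes f [tuple of y :: v] 0%N /\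
      forall z, (z < y)%N -> exists k, computes f [tuple of z :: v] k.+1
  end.

(* The rational with code (a, b, c); every rational has such a code. *)
Definition rat_of_code (R : realType) (a b c : nat) : R :=
  (a%:R - b%:R) / c.+1%:R.

(* Bijection from binary strings to natural numbers (bijective base 2). *)
Definition str_code (x : seq bool) : nat :=
  foldr (fun (b : bool) k => (k.*2 + b).+1) 0%N x.

Definition computable_real (R : realType) (x : R) : Prop :=
  exists fa fb fc : recfun 1, forall n : nat, exists a b c : nat,
    [/\ computes fa [tuple n] a, computes fb [tuple n] b,
        computes fc [tuple n] c & `|x - rat_of_code R a b c| <= 2 ^- n].

(* The interval x Omega: the sequences having x as a prefix. *)
Definition cylinder (x : seq bool) : set (nat -> bool) :=
  [set w | mkseq w (size x) = x].

(* {0,1}^N with the sigma-algebra generated by the intervals. *)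
Definition Omega : measurableType _ := g_sigma_algebraType (range cylinder).

Definition le_Omega (w w' : Omega) : Prop := forall i, (w i <= w' i)%N.

Definition is_bernoulli (R : realType) (p : R) (B : probability Omega R) :=
  forall x : seq bool,
    B (cylinder x) = (\prod_(b <- x) (if b then p else 1 - p))%:E.

(* For 0 <= p <= 1 this is the Bernoulli measure, by [bernoulli_measureP] below; the
   value is irrelevant for other p. *)
Definition bernoulli_measure (R : realType) (p : R) : probability Omega R :=
  get [set B | is_bernoulli p B].

Definition coupled_below (R : realType) (P Q : probability Omega R) : Prop :=
  exists C : {measure set (Omega * Omega) -> \bar R},
    [/\ forall A : set Omega, measurable A -> C (fst @^-1` A) = P A,
        forall A : set Omega, measurable A -> C (snd @^-1` A) = Q A
      & C [set w | le_Omega w.1 w.2] = 1%E].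

Local Open Scope ereal_scope.

(* [e] enumerates, from the code (a, b, c) of a rational r, codes of strings
   whose intervals have union {r < f}. As [e] is partial, the enumerated family
   may be empty. *)
Definition lower_semicomputable (R : realType) (f : Omega -> \bar R) : Prop :=
  exists e : recfun 4, forall a b c : nat,
    [set w | (rat_of_code R a b c)%:E < f w] =
    \bigcup_(x in [set x | exists n, computes e [tuple a; b; c; n] (str_code x)])
      cylinder x.

Definition monotone_Omega (R : realType) (f : Omega -> \bar R) : Prop :=
  forall w w', le_Omega w w' -> f w <= f w'.

Definition sparseness_test (R : realType) (p : R) (f : Omega -> \bar R) : Prop :=
  [/\ forall w, 0 <= f w, monotone_Omega f, lower_semicomputable f
    & \int[bernoulli_measure p]_w f w <= 1].

Definition class_test (R : realType) (C : set (probability Omega R))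
    (t : Omega -> \bar R) : Prop :=
  [/\ forall w, 0 <= t w, lower_semicomputable t
    & forall P, C P -> \int[P]_w t w <= 1].

Definition universal (R : realType) (T : set (Omega -> \bar R))
    (u : Omega -> \bar R) : Prop :=
  T u /\ forall t, T t ->
    exists2 c : R, (0 < c)%R & forall w, t w <= c%:E * u w.

Definition sparse_measures (R : realType) (p : R) : set (probability Omega R) :=
  [set P | coupled_below P (bernoulli_measure p)].

Local Close Scope ereal_scope.

(* Existence of the Bernoulli measure, as the image of Lebesgue measure on
   [0, 1[ under the itinerary map: [lo x] is the left end of the subinterval of
   length [wd x] coded by the string x, and [bits u] is the sequence coding the
   successive subintervals containing u. *)
Section bernoulli_existence.
Variables (R : realType) (p : R).

Let wd (x : seq bool) : R := \prod_(b <- x) (if b then p else 1 - p).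

Let lo (x : seq bool) : R :=
  foldr (fun (b : bool) (l : R) => if b then (1 - p) + p * l else (1 - p) * l)
    0 x.

Let mid x := lo x + (1 - p) * wd x.

Let wd_rcons x b : wd (rcons x b) = wd x * (if b then p else 1 - p).
Proof. by rewrite /wd -cats1 big_cat big_seq1. Qed.

Let wd_cons b x : wd (b :: x) = (if b then p else 1 - p) * wd x.
Proof. by rewrite /wd big_cons. Qed.

Let lo_rcons x b : lo (rcons x b) = if b then mid x else lo x.
Proof.
rewrite /mid; elim: x => [|a x ih] /=.
  by rewrite /wd big_nil; case: b; rewrite ?mulr0 ?addr0 ?add0r ?mulr1.
rewrite {}ih wd_cons; case: a; case: b => //; ring.
Qed.

Let pre (u : R) := fix pre n : seq bool :=
  if n is m.+1 then rcons (pre m) (mid (pre m) <= u) else [::].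

Let bits (u : R) : Omega := fun n => mid (pre u n) <= u.

Let mkseq_bits u n : mkseq (bits u) n = pre u n.
Proof. by elim: n => [//|n ih]; rewrite mkseqS ih. Qed.

Let measurable_pre x : measurable [set u | pre u (size x) = x].
Proof.
elim/last_ind: x => [|x b ih].
  by rewrite (_ : [set _ | _] = setT) //; apply/seteqP; split.
rewrite (_ : [set _ | _] = [set u | pre u (size x) = x] `&`
  (if b then `[mid x, +oo[ else `]-oo, mid x[)%classic).
  by apply: measurableI => //; case: (b).
apply/seteqP; split=> u /=; rewrite size_rcons /=.
  move=> /rcons_inj[-> <-]; split=> //; case: leP => h /=.
    by rewrite in_itv/= h.
  by rewrite in_itv.
by move=> [->]; case: b => /=; rewrite in_itv/= ?andbT; case: leP.
Qed.

Let measurable_bits : measurable_fun [set: R] bits.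
Proof.
apply: (@measurability _ _ _ Omega _ _ (range cylinder)) => // _ [_ [x _ <-] <-]; rewrite setTI.
rewrite (_ : _ @^-1` _ = [set u | pre u (size x) = x]) //.
by apply/seteqP; split=> u; rewrite /cylinder /= mkseq_bits.
Qed.

Hypothesis p01 : 0 <= p <= 1.

Let wd_ge0 x : 0 <= wd x.
Proof.
have /andP[p0 p1] := p01; apply: prodr_ge0 => b _.
by case: b; rewrite ?subr_ge0.
Qed.

Let lo_bounds x : 0 <= lo x /\ lo x + wd x <= 1.
Proof.
have /andP[p0 p1] := p01.
elim: x => [|b x [ih1 ih2]] /=; first by rewrite /wd big_nil; split; lra.
rewrite wd_cons; case: b; split; nra.
Qed.

Let preP x (u : R) : 0 <= u < 1 -> pre u (size x) = x <-> lo x <= u < lo x + wd x.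
Proof.
have /andP[p0 p1] := p01.
move=> u01; elim/last_ind: x => [|x b [ih1 ih2]] /=.
  by rewrite /wd big_nil add0r; split.
rewrite size_rcons /= lo_rcons wd_rcons; split.
  move=> /rcons_inj[e]; rewrite e; move: (ih1 e) => /andP[h1 h2] <-.
  by case: (leP (mid x) u) => h /=; apply/andP; move: h; rewrite /mid => h; split; lra.
move=> h; have w0 := wd_ge0 x; have e : pre u (size x) = x.
  apply: ih2; move: h; rewrite /mid.
  by case: b => /andP[h1 h2]; apply/andP; split; nra.
rewrite e; congr rcons; case: b h => /andP[h1 h2]; first exact: h1.
by apply/negbTE; rewrite -ltNge /mid; lra.
Qed.

Let leb01 := mrestr (@lebesgue_measure R) (measurable_itv `[(0:R), 1[).

Let mu : {measure set Omega -> \bar R} :=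
  measure_function_pushforward__canonical__measure_function_Measure
    leb01 measurable_bits.

Let mu_cylinder x : mu (cylinder x) = (wd x)%:E.
Proof.
have [l0 l1] := lo_bounds x; have w0 := wd_ge0 x.
change (lebesgue_measure (bits @^-1` cylinder x `&` `[0, 1[%classic) =
  (wd x)%:E).
rewrite (_ : _ `&` _ = `[lo x, lo x + wd x[%classic); last first.
  apply/seteqP; split=> u /=.
    by rewrite /cylinder /= mkseq_bits !in_itv /= => -[+ h]; move/(preP x h).
  rewrite !in_itv /= => h; have h' : 0 <= u < 1.
    by case/andP: h => h1 h2; apply/andP; split; lra.
  by split=> //; rewrite /cylinder /= mkseq_bits; apply/(preP x h').
rewrite lebesgue_measure_itv /= lte_fin; case: ltP => h.
  by rewrite -EFinB; congr EFin; ring.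
by congr EFin; lra.
Qed.

Let mu_setT : mu setT = 1%E.
Proof.
have := mu_cylinder [::]; rewrite /wd big_nil => <-; apply: (congr1 mu).
by apply/seteqP; split.
Qed.

Lemma bernoulli_measureP : is_bernoulli p (bernoulli_measure p).
Proof.
apply: (@getPex _ [set B | is_bernoulli p B]).
pose B : probability Omega R := mnormalize mu (point : probability Omega R).
exists B => x; rewrite /B /=.
by rewrite /mnormalize mu_setT onee_eq0 /= invr1 mule1 mu_cylinder.
Qed.

End bernoulli_existence.

(* Main.v *)
(* A monotone function has a smaller integral for P than for B_p whenever P is
   coupled below B_p, so r is a test for the class. Conversely, let t be a test
   for the class and let t'(w) be the supremum of t over the sequences below w.
   Then t' is monotone, dominates t, and {q < t'} is the union of the intervals
   y Omega for the strings y dominating some enumerated x, so t' is lower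
   semicomputable. To bound its integral, let T x be the infimum of t on
   x Omega. The maximum of T over the strings below the first n bits of w
   increases to t'(w) with n, and if phi w is a maximising string followed by
   zeros then it is at most t (phi w). As phi w <= w, the image of B_p under phi
   is coupled below B_p, so the integral of t o phi is at most 1; conclude by
   monotone convergence. Universality of r among sparseness tests then applies
   to t'. *)

From HB Require Import structures.
From mathcomp Require Import all_boot all_order all_algebra.
From mathcomp Require Import all_classical all_reals all_analysis.
From mathcomp Require Import measurable_realfun zify.
Require Import Defs.

Set Implicit Arguments.
Unset Strict Implicit.
Unset Printing Implicit Defensive.

(** * Total recursive functions and their closure properties *)

(** The equivalence packs existence and uniqueness of the value, so the relation [computes f] can be
    rewritten as an equation wherever it occurs. *)
Definition total_recursive n (F : n.-tuple nat -> nat) : Prop :=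
  exists f : recfun n, forall v y, computes f v y <-> y = F v.

Lemma eq_total_recursive n (F G : n.-tuple nat -> nat) :
  F =1 G -> total_recursive F -> total_recursive G.
Proof. by move=> FG [f fP]; exists f => v y; rewrite -FG. Qed.

Lemma total_recursive_nth n i :
  i < n -> total_recursive (fun v : n.-tuple nat => nth 0 v i).
Proof.
move=> lt_in; exists (rf_proj (Ordinal lt_in)) => v y /=.
by rewrite (tnth_nth 0).
Qed.

Lemma total_recursive_comp m n (F : m.-tuple nat -> nat)
    (G : 'I_m -> n.-tuple nat -> nat) :
  total_recursive F -> (forall i, total_recursive (G i)) ->
  total_recursive (fun v => F [tuple G i v | i < m]).
Proof.
move=> [f fP] /choice[g gP]; exists (rf_comp f g) => v y /=; split.
  move=> [w wP /fP ->]; congr F; apply: eq_from_tnth => i.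
  by rewrite tnth_mktuple; apply/gP.
move=> ->; exists [tuple G i v | i < m]; last exact/fP.
by move=> i; rewrite tnth_mktuple; apply/gP.
Qed.

Lemma total_recursive_comp1 n (F : nat -> nat) (G : n.-tuple nat -> nat) :
  total_recursive (fun v : 1.-tuple nat => F (nth 0 v 0)) ->
  total_recursive G -> total_recursive (fun v => F (G v)).
Proof.
move=> hF hG.
apply: eq_total_recursive (total_recursive_comp hF (fun=> hG)) => v /=.
by rewrite enum_ordSl.
Qed.

Lemma total_recursive_comp2 n (F : nat -> nat -> nat)
    (G1 G2 : n.-tuple nat -> nat) :
  total_recursive (fun v : 2.-tuple nat => F (nth 0 v 0) (nth 0 v 1)) ->
  total_recursive G1 -> total_recursive G2 ->
  total_recursive (fun v => F (G1 v) (G2 v)).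
Proof.
move=> hF h1 h2.
have hG (i : 'I_2) : total_recursive (fun v => if i == ord0 then G1 v else G2 v).
  by case: (i == ord0).
apply: eq_total_recursive (total_recursive_comp hF hG) => v /=.
by rewrite !enum_ordSl.
Qed.

Lemma total_recursive_comp3 n (F : nat -> nat -> nat -> nat)
    (G1 G2 G3 : n.-tuple nat -> nat) :
  total_recursive
    (fun v : 3.-tuple nat => F (nth 0 v 0) (nth 0 v 1) (nth 0 v 2)) ->
  total_recursive G1 -> total_recursive G2 -> total_recursive G3 ->
  total_recursive (fun v => F (G1 v) (G2 v) (G3 v)).
Proof.
move=> hF h1 h2 h3.
have hG (i : 'I_3) : total_recursive
    (fun v => if i == 0 :> nat then G1 v else if i == 1 :> nat then G2 v else G3 v).
  by case: (i == 0 :> nat) => //; case: (i == 1 :> nat).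
apply: eq_total_recursive (total_recursive_comp hF hG) => v /=.
by rewrite !enum_ordSl.
Qed.

Lemma total_recursive_const n k : total_recursive (fun _ : n.-tuple nat => k).
Proof.
elim: k => [|k ih]; first by exists (rf_zero n).
apply: (total_recursive_comp1 (F := succn)) ih.
by exists rf_succ => v y /=; rewrite /thead (tnth_nth 0).
Qed.

Lemma total_recursive_rec n (H : nat -> n.-tuple nat -> nat)
    (G : n.+2.-tuple nat -> nat) :
  total_recursive (H 0) -> total_recursive G ->
  (forall k v, H k.+1 v = G [tuple of k :: H k v :: v]) ->
  total_recursive (fun v : n.+1.-tuple nat => H (nth 0 v 0) (behead_tuple v)).
Proof.
move=> [f fP] [g gP] HS; exists (rf_rec f g) => v y /=.
have -> : thead v = nth 0 v 0 by rewrite /thead (tnth_nth 0).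
split=> [[s [/fP s0 sS ->]]|->].
  have : nth 0 v 0 <= nth 0 v 0 by [].
  (* The induction keeps the bound on k, since the sequence [s] is constrained only up to the
     recursion argument. *)
  elim: {1 3 4}(nth 0 v 0) => [//|k ih] lt_k.
  by have /gP -> := sS _ lt_k; rewrite HS ih // ltnW.
exists (fun k => H k (behead_tuple v)); split=> //; first exact/fP.
by move=> k _; apply/gP; rewrite HS.
Qed.

Lemma total_recursive_rec1 (H : nat -> nat) (G : nat -> nat -> nat) :
  total_recursive (fun v : 2.-tuple nat => G (nth 0 v 0) (nth 0 v 1)) ->
  (forall k, H k.+1 = G k (H k)) ->
  total_recursive (fun v : 1.-tuple nat => H (nth 0 v 0)).
Proof.
move=> hG HS.
apply: (@total_recursive_rec 0 (fun k _ => H k)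
  (fun v => G (nth 0 v 0) (nth 0 v 1))) => //.
exact: total_recursive_const.
Qed.

Lemma total_recursive_rec2 (H : nat -> nat -> nat)
    (G : nat -> nat -> nat -> nat) :
  total_recursive (fun v : 1.-tuple nat => H 0 (nth 0 v 0)) ->
  total_recursive
    (fun v : 3.-tuple nat => G (nth 0 v 0) (nth 0 v 1) (nth 0 v 2)) ->
  (forall k x, H k.+1 x = G k (H k x) x) ->
  total_recursive (fun v : 2.-tuple nat => H (nth 0 v 0) (nth 0 v 1)).
Proof.
move=> h0 hG HS.
have := @total_recursive_rec 1 (fun k v => H k (nth 0 v 0))
  (fun v => G (nth 0 v 0) (nth 0 v 1) (nth 0 v 2)) h0 hG.
move=> /(_ (fun k v => HS k _)); apply: eq_total_recursive => v.
by rewrite nth_behead.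
Qed.

Lemma total_recursive_rec3 (H : nat -> nat -> nat -> nat)
    (G : nat -> nat -> nat -> nat -> nat) :
  total_recursive (fun v : 2.-tuple nat => H 0 (nth 0 v 0) (nth 0 v 1)) ->
  total_recursive (fun v : 4.-tuple nat =>
    G (nth 0 v 0) (nth 0 v 1) (nth 0 v 2) (nth 0 v 3)) ->
  (forall k x y, H k.+1 x y = G k (H k x y) x y) ->
  total_recursive
    (fun v : 3.-tuple nat => H (nth 0 v 0) (nth 0 v 1) (nth 0 v 2)).
Proof.
move=> h0 hG HS.
have := @total_recursive_rec 2 (fun k v => H k (nth 0 v 0) (nth 0 v 1))
  (fun v => G (nth 0 v 0) (nth 0 v 1) (nth 0 v 2) (nth 0 v 3)) h0 hG.
move=> /(_ (fun k v => HS k _ _)); apply: eq_total_recursive => v.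
by rewrite !nth_behead.
Qed.

Lemma total_recursiveD n (F G : n.-tuple nat -> nat) :
  total_recursive F -> total_recursive G ->
  total_recursive (fun v => F v + G v).
Proof.
apply: (total_recursive_comp2 (F := addn)).
apply: (total_recursive_rec2 (H := addn) (G := fun _ h _ => h.+1)) => //.
- exact: total_recursive_nth.
- apply: (total_recursive_comp1 (F := succn)); last exact: total_recursive_nth.
  by exists rf_succ => v y /=; rewrite /thead (tnth_nth 0).
Qed.

Lemma total_recursive_pred n (F : n.-tuple nat -> nat) :
  total_recursive F -> total_recursive (fun v => (F v).-1).
Proof.
apply: (total_recursive_comp1 (F := predn)).
by apply: (total_recursive_rec1 (H := predn) (G := fun k _ => k)) => //;
  exact: total_recursive_nth.
Qed.

Lemma total_recursiveB n (F G : n.-tuple nat -> nat) :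
  total_recursive F -> total_recursive G ->
  total_recursive (fun v => F v - G v).
Proof.
(* The arguments are swapped because recursion runs on the first variable, here the subtrahend. *)
move=> hF hG; apply: (total_recursive_comp2 (F := fun k x => x - k)) hG hF.
apply: (total_recursive_rec2 (H := fun k x => x - k) (G := fun _ h _ => h.-1)).
- by apply: eq_total_recursive (total_recursive_nth (ltn0Sn 0)) => v; rewrite subn0.
- exact/total_recursive_pred/total_recursive_nth.
- by move=> k x; rewrite subnS.
Qed.

Lemma total_recursiveM n (F G : n.-tuple nat -> nat) :
  total_recursive F -> total_recursive G ->
  total_recursive (fun v => F v * G v).
Proof.
apply: (total_recursive_comp2 (F := muln)).
apply: (total_recursive_rec2 (H := muln) (G := fun _ h x => x + h)) => //.
- exact: total_recursive_const.
- by apply: total_recursiveD; exact: total_recursive_nth.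
Qed.

(** A case distinction is a recursion on [K v] that starts at the first branch and whose step always
    returns the second. *)
Lemma total_recursive_if n (K F G : n.-tuple nat -> nat) :
  total_recursive K -> total_recursive F -> total_recursive G ->
  total_recursive (fun v => if K v == 0 then F v else G v).
Proof.
apply: (total_recursive_comp3 (F := fun k x y => if k == 0 then x else y)).
by apply: (total_recursive_rec3
  (H := fun k x y => if k == 0 then x else y) (G := fun _ _ _ y => y)) => //;
  exact: total_recursive_nth.
Qed.

Lemma total_recursive_odd n (F : n.-tuple nat -> nat) :
  total_recursive F -> total_recursive (fun v => odd (F v) : nat).
Proof.
apply: (total_recursive_comp1 (F := fun k => odd k : nat)).
apply: (total_recursive_rec1 (H := fun k => odd k : nat)
  (G := fun _ h => 1 - h)) => [|k /=].
- by apply: total_recursiveB; [exact: total_recursive_const|exact: total_recursive_nth].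
- by case: (odd k).
Qed.

(** With rounding down, the half of k + 1 is k minus the half of k. *)
Lemma total_recursive_half n (F : n.-tuple nat -> nat) :
  total_recursive F -> total_recursive (fun v => (F v)./2).
Proof.
apply: (total_recursive_comp1 (F := half)).
apply: (total_recursive_rec1 (H := half) (G := fun k h => k - h)) => [|k].
- by apply: total_recursiveB; exact: total_recursive_nth.
- by lia.
Qed.

(** * Codes of strings and the bitwise order on them *)

Definition str_tail (i u : nat) : nat := iter i (fun k => k.-1./2) u.

(** The code of [b :: x] is 2k + b + 1 with k the code of [x], so predecessor followed by halving
    drops the first bit. The code 0 of the empty string is a fixed point. *)
Lemma str_tail_cons i b x : str_tail i.+1 (str_code (b :: x)) = str_tail i (str_code x).
Proof.
rewrite /str_tail iterSr /=; congr iter.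
by case: b; rewrite ?addn1 ?addn0 /= ?uphalf_double ?doubleK.
Qed.

(** This lets any output of an enumeration be read as the code of a string. *)
Lemma str_code_surj u : exists x, str_code x = u.
Proof.
elim/ltn_ind: u => -[|u] ih; first by exists [::].
have [|x xP] := ih u./2; first by lia.
by exists (odd u :: x); rewrite /= xP; lia.
Qed.

Lemma size_str_code x : size x <= str_code x.
Proof. by elim: x => //= b x ih; lia. Qed.

(* A code is 0 for the empty string, odd for a string starting with 0, and
   positive and even for a string starting with 1. *)
Definition bit_conflict (u v : nat) : nat :=
  if u == 0 then v else if v == 0 then 1 else (1 - odd u) * odd v.

(** As [all2] fails on lists of different sizes, only strings of equal length are related. *)
Definition str_le (x y : seq bool) := all2 implb x y.

(** Including the index i = [size x] forces equal lengths: there the tail of [x] is empty and the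
    conflict is the code of what remains of [y]. A shorter [y] already conflicts where it ends. *)
Lemma bit_conflict_str_le x y :
  (forall i, i <= size x ->
    bit_conflict (str_tail i (str_code x)) (str_tail i (str_code y)) = 0) <->
  str_le x y.
Proof.
elim: x y => [|b x ih] [|c y].
- by split=> // _ [].
- by split=> [/(_ 0 isT)//|].
- by split=> [/(_ 0 isT)//|].
have e0 : bit_conflict (str_code (b :: x)) (str_code (c :: y)) = ~~ (b ==> c) :> nat.
  by rewrite /bit_conflict /= !oddD !odd_double; case: b; case: c.
have -> : str_le (b :: x) (c :: y) = (b ==> c) && str_le x y by [].
split=> [h|/andP[bc /ih h] [_|i lt_i]].
- apply/andP; split; first by have := h 0 isT; rewrite e0; case: (b ==> c).
  by apply/ih => i le_i; have := h i.+1 le_i; rewrite !str_tail_cons.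
- by rewrite e0 bc.
- by rewrite !str_tail_cons h.
Qed.

(** A bounded universal quantifier in the form of a sum, which is recursive in its bound. *)
Definition conflicts (k u v : nat) : nat :=
  \sum_(i < k) bit_conflict (str_tail i u) (str_tail i v).

(** The code of [x] bounds its size, so the sum covers every relevant position. Positions beyond the
    size add nothing, both tails being empty there. *)
Lemma conflicts_str_le x y :
  (conflicts (str_code x).+1 (str_code x) (str_code y) == 0) = str_le x y.
Proof.
rewrite sum_nat_eq0; apply/forallP/idP => [h|/bit_conflict_str_le h i].
  apply/bit_conflict_str_le => i le_i.
  have lt_i : i < (str_code x).+1.
    by rewrite ltnS (leq_trans le_i) // size_str_code.
  exact/eqP/(h (Ordinal lt_i)).
apply/eqP; have [/h //|lt_i] := leqP i (size x).
have tail0 z j : size z <= j -> str_tail j (str_code z) = 0.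
  elim: z j => [|b z ih] [|j] //=.
    by move=> _; elim: j => //= j ->.
  by move=> /ih; rewrite -(str_tail_cons j b).
(* No conflict at index [size x] means that [y] has ended too, and its tail then stays 0. *)
have := h _ (leqnn (size x)); rewrite tail0 // /bit_conflict eqxx => ty0.
rewrite tail0 1?ltnW // eqxx /str_tail.
have {}ty0 : forall j, size x <= j -> str_tail j (str_code y) = 0.
  move=> j /subnK <-; rewrite /str_tail iterD -/(str_tail (size x) _) ty0.
  by elim: (_ - _) => //= ? ->.
exact/ty0/ltnW.
Qed.

(** * Integer square roots and decoding of pairs *)

Fixpoint sqrt_nat (n : nat) : nat :=
  if n is k.+1 then
    if (sqrt_nat k).+1 * (sqrt_nat k).+1 - k.+1 == 0 then (sqrt_nat k).+1
    else sqrt_nat k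
  else 0.

Lemma sqrt_natP n :
  sqrt_nat n * sqrt_nat n <= n < (sqrt_nat n).+1 * (sqrt_nat n).+1.
Proof. by elim: n => //= n ih; case: eqP; nia. Qed.

(** Decodes (m, k) from $(m+k)^2+m$, whose integer square root is m + k. *)
Definition unpair1 (n : nat) : nat := n - sqrt_nat n * sqrt_nat n.
Definition unpair2 (n : nat) : nat := sqrt_nat n - unpair1 n.

Lemma unpair_surj m k : exists n, unpair1 n = m /\ unpair2 n = k.
Proof.
exists ((m + k) * (m + k) + m); rewrite /unpair2 /unpair1.
have -> : sqrt_nat ((m + k) * (m + k) + m) = m + k.
  by have := sqrt_natP ((m + k) * (m + k) + m); nia.
by lia.
Qed.

(** * Recursiveness of the functions on codes *)

Section string_functions.
Variable n : nat.
Implicit Types F G : n.-tuple nat -> nat.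

Lemma total_recursive_str_tail F G : total_recursive F -> total_recursive G ->
  total_recursive (fun v => str_tail (F v) (G v)).
Proof.
apply: (total_recursive_comp2 (F := str_tail)).
apply: (total_recursive_rec2 (H := str_tail) (G := fun _ h _ => h.-1./2)) => //.
- exact: total_recursive_nth.
- exact/total_recursive_half/total_recursive_pred/total_recursive_nth.
Qed.

Lemma total_recursive_bit_conflict F G :
  total_recursive F -> total_recursive G ->
  total_recursive (fun v => bit_conflict (F v) (G v)).
Proof.
move=> hF hG; apply: total_recursive_if => //; apply: total_recursive_if => //.
  exact: total_recursive_const.
apply: total_recursiveM; last exact: total_recursive_odd.
apply: total_recursiveB; first exact: total_recursive_const.
exact: total_recursive_odd.
Qed.

Lemma total_recursive_sqrt F :
  total_recursive F -> total_recursive (fun v => sqrt_nat (F v)).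
Proof.
apply: (total_recursive_comp1 (F := sqrt_nat)).
apply: (total_recursive_rec1 (H := sqrt_nat)
  (G := fun k h => if (1 + h) * (1 + h) - (1 + k) == 0 then 1 + h else h)) => //.
have h0 := total_recursive_nth (ltn0Sn 1).
have h1 := total_recursive_nth (ltnSn 1).
have c1 := total_recursive_const 2 1.
have hS := total_recursiveD c1 h1.
apply: (total_recursive_if _ hS h1).
exact: (total_recursiveB (total_recursiveM hS hS) (total_recursiveD c1 h0)).
Qed.

End string_functions.

Lemma total_recursive_conflicts n (F G K : n.-tuple nat -> nat) :
  total_recursive F -> total_recursive G -> total_recursive K ->
  total_recursive (fun v => conflicts (F v) (G v) (K v)).
Proof.
apply: (total_recursive_comp3 (F := conflicts)).
apply: (total_recursive_rec3 (H := conflicts) (G := fun k h u v =>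
  h + bit_conflict (str_tail k u) (str_tail k v))).
- apply: eq_total_recursive (total_recursive_const 2 0) => v.
  by rewrite /conflicts big_ord0.
- apply: total_recursiveD; first exact: total_recursive_nth.
  by apply: total_recursive_bit_conflict; apply: total_recursive_str_tail;
    exact: total_recursive_nth.
- by move=> k u v; rewrite /conflicts big_ord_recr.
Qed.

Lemma total_recursive_unpair1 n (F : n.-tuple nat -> nat) :
  total_recursive F -> total_recursive (fun v => unpair1 (F v)).
Proof.
by move=> hF; apply: (total_recursiveB hF); apply: total_recursiveM;
  exact: total_recursive_sqrt.
Qed.

(** * Closing an enumeration of strings upwards *)

Definition dominating_code (u n : nat) : nat :=
  if conflicts u.+1 u (unpair2 n) == 0 then unpair2 n else u.

Lemma total_recursive_dominating_code :
  total_recursive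
    (fun v : 2.-tuple nat => dominating_code (nth 0 v 0) (nth 0 v 1)).
Proof.
have h0 := total_recursive_nth (ltn0Sn 1).
have h1 := total_recursive_nth (ltnSn 1).
have h2 : total_recursive (fun v : 2.-tuple nat => unpair2 (nth 0 v 1)).
  exact: total_recursiveB (total_recursive_sqrt h1) (total_recursive_unpair1 h1).
apply: (total_recursive_if _ h2 h0).
apply: total_recursive_conflicts => //.
exact: (total_recursiveD (total_recursive_const 2 1) h0).
Qed.

(** The index n encodes an index for [e] together with a guess for the code of [y]. The guess is
    output when it dominates the string produced by [e]; if [e] is undefined there, so is [e']. *)
Lemma upward_enumeration (e : recfun 4) : exists e' : recfun 4,
  forall a b c y,
    (exists n, computes e' [tuple a; b; c; n] (str_code y)) <->
    (exists2 x, exists n, computes e [tuple a; b; c; n] (str_code x) &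
                str_le x y).
Proof.
have [d dP] := total_recursive_dominating_code.
have [q qP] := total_recursive_unpair1 (total_recursive_nth (ltnSn 3)).
(* [g] keeps the rational code (a, b, c) and replaces n by its first component. *)
pose g (i : 'I_4) : recfun 4 := if i == ord_max then q else rf_proj i.
pose e1 := rf_comp e g.
pose e' := rf_comp d (fun i : 'I_2 => if i == ord0 then e1 else rf_proj ord_max).
have e1P a b c n u : computes e1 [tuple a; b; c; n] u <->
    computes e [tuple a; b; c; unpair1 n] u.
  have gP (w : 4.-tuple nat) :
      (forall i, computes (g i) [tuple a; b; c; n] (tnth w i)) <->
      w = [tuple a; b; c; unpair1 n].
    split=> [h|-> [[|[|[|[|//]]]] ?]]; rewrite /g ?(tnth_nth 0) //=; last first.
      exact/qP.
    apply: eq_from_tnth => i; have := h i; rewrite /g.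
    case: i => [[|[|[|[|//]]]] ?]; rewrite !(tnth_nth 0) //=.
    by move=> /qP.
  split=> [[w /gP ->]//|h]; exists [tuple a; b; c; unpair1 n] => //.
  exact/gP.
have e'P a b c n y : computes e' [tuple a; b; c; n] y <->
    exists2 u, computes e [tuple a; b; c; unpair1 n] u & y = dominating_code u n.
  split=> [[w wP /dP ->]|[u eu ->]].
    exists (nth 0 w 0).
      by apply/e1P; rewrite -(tnth_nth 0 w ord0); exact: (wP ord0).
    have := wP ord_max; rewrite (tnth_nth 0 w) /= => ->.
    by rewrite (tnth_nth 0).
  exists [tuple u; n]; last exact/dP.
  move=> [[|[|//]] ?]; rewrite (tnth_nth 0) //=; exact/e1P.
exists e' => a b c y; split=> [[n /e'P[u eu]]|[x [m em] xy]].
  have [x xP] := str_code_surj u; rewrite -{}xP in eu *.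
  rewrite /dominating_code; case: ifP => [+ yE|_ yx].
    by rewrite -yE conflicts_str_le => xy; exists x => //; exists (unpair1 n).
  (* A wrong guess makes [e'] repeat the string given by [e], which is harmless because [str_le] is
     reflexive. *)
  exists y; first by exists (unpair1 n); rewrite yx.
  by elim: (y) => //= -[].
have [n [n1 n2]] := unpair_surj m (str_code y).
exists n; apply/e'P; exists (str_code x); first by rewrite n1.
by rewrite /dominating_code n2 conflicts_str_le xy.
Qed.

Import Order.TTheory GRing.Theory Num.Theory.

Local Open Scope classical_set_scope.
Local Open Scope ring_scope.

(** * Prefixes, intervals and the order on sequences *)

Lemma str_leP (x y : seq bool) :
  str_le x y <->
  size x = size y /\ forall i, (nth false x i <= nth false y i)%N.
Proof.
elim: x y => [|b x ih] [|c y].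
- by split=> // _; split=> // i; rewrite nth_nil.
- by split=> // -[].
- by split=> // -[].
split=> [/andP[bc /ih[xy h]]|[[xy] h]].
  split; first by rewrite /= xy.
  by case=> [|i] /=; [case: (b) (c) bc => -[]|exact: h].
apply/andP; split; first by have := h 0%N; case: (b) (c) => -[].
by apply/ih; split=> // i; exact: (h i.+1).
Qed.

Lemma cylinderP (x : seq bool) (w : Omega) :
  cylinder x w <-> forall i, (i < size x)%N -> w i = nth false x i.
Proof.
rewrite /cylinder /=; split=> [xw i ltix|h]; first by rewrite -xw nth_mkseq.
apply: (@eq_from_nth _ false) => [|i]; rewrite size_mkseq // => ltix.
by rewrite nth_mkseq ?h.
Qed.

Lemma cylinder_mkseq (w : Omega) n : cylinder (mkseq w n) w.
Proof. by rewrite /cylinder /= size_mkseq. Qed.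

Lemma sub_cylinder_mkseq (w : Omega) m n : (m <= n)%N ->
  cylinder (mkseq w n) `<=` cylinder (mkseq w m).
Proof.
move=> mn w' /cylinderP h; apply/cylinderP => i; rewrite size_mkseq => im.
by rewrite h ?size_mkseq ?(leq_trans im) // !nth_mkseq ?(leq_trans im).
Qed.

Lemma str_le_mkseq (w w' : Omega) n :
  le_Omega w w' -> str_le (mkseq w n) (mkseq w' n).
Proof.
move=> ww'; apply/str_leP; rewrite !size_mkseq; split=> // i.
have [lt_in|le_ni] := ltnP i n; first by rewrite !nth_mkseq.
by rewrite !nth_default ?size_mkseq.
Qed.

(** The least sequence in [cylinder x]. *)
Definition zero_pad (x : seq bool) : Omega := fun i => nth false x i.

Lemma cylinder_zero_pad x : cylinder x (zero_pad x).
Proof. exact/cylinderP. Qed.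

Lemma le_zero_pad (x y : seq bool) (w : Omega) :
  str_le x y -> cylinder y w -> le_Omega (zero_pad x) w.
Proof.
move=> /str_leP[sxy xy] /cylinderP yw i.
have [lt_iy|le_yi] := ltnP i (size y); first by rewrite yw.
by rewrite /zero_pad nth_default ?sxy.
Qed.

Lemma measurable_cylinder x : measurable (cylinder x : set Omega).
Proof. by apply: sub_sigma_algebra; exists x. Qed.

(** Each preimage is a finite union of intervals, there being finitely many strings of length n. *)
Lemma measurable_fun_prefix d (T : measurableType d) n (f : seq bool -> T) :
  measurable_fun setT (fun w : Omega => f (mkseq w n)).
Proof.
move=> _ A mA; rewrite setTI.
rewrite (_ : _ @^-1` _ =
    \bigcup_(x in [set x : n.-tuple bool | A (f x)]) cylinder x); last first.
  apply/seteqP; split=> w /=.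
    move=> Aw; exists (Tuple (introT eqP (size_mkseq w n))) => //.
    exact: cylinder_mkseq.
  by move=> [x /= Ax]; rewrite /cylinder /= size_tuple => ->.
apply: fin_bigcup_measurable => // x _; exact: measurable_cylinder.
Qed.

Lemma rat_of_code_dense (R : realType) (x y : R) :
  x < y -> exists a b c, x < rat_of_code R a b c < y.
Proof.
move=> /rat_in_itvoo[q]; rewrite in_itv /= => qP.
have [c cE] : exists c, denq q = c.+1%:Z.
  by have := denq_gt0 q; case: (denq q) => [[|c]|] // _; exists c.
have [a [b abE]] : exists a b, (numq q)%:~R = a%:R - b%:R :> R.
  case: (numq q) => k; first by exists k, 0%N; rewrite subr0.
  by exists 0%N, k.+1; rewrite sub0r NegzE mulrNz.
by exists a, b, c; rewrite /rat_of_code -abE; move: qP; rewrite /ratr cE.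
Qed.

(** * Lower semicontinuity and measurability *)

Section lower_semicontinuity.
Local Open Scope ereal_scope.
Variable R : realType.
Implicit Types t : Omega -> \bar R.

Definition cylinder_inf t (x : seq bool) : \bar R := ereal_inf (t @` cylinder x).

Lemma cylinder_inf_le t x w : cylinder x w -> cylinder_inf t x <= t w.
Proof. by move=> xw; apply: ereal_inf_lbound; exists w. Qed.

Lemma cylinder_inf_ge0 t x : (forall w, 0 <= t w) -> 0 <= cylinder_inf t x.
Proof. by move=> t0; apply: le_ereal_inf_tmp => _ [w _ <-]. Qed.

Lemma nondecreasing_cylinder_inf t (w : Omega) :
  {homo (fun n => cylinder_inf t (mkseq w n)) : m n / (m <= n)%N >-> m <= n}.
Proof.
move=> m n mn; apply: le_ereal_inf_tmp => _ [w' w'n <-].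
exact: cylinder_inf_le (sub_cylinder_mkseq mn w'n).
Qed.

(** Were the supremum smaller than [t w], some rational would lie strictly between. The set where
    [t] exceeds it contains an interval around [w], and the infimum on that interval would be at
    least this rational. *)
Lemma lower_semicomputable_sup t w :
  (forall w, 0 <= t w) -> lower_semicomputable t ->
  t w = ereal_sup (range (fun n => cylinder_inf t (mkseq w n))).
Proof.
move=> t0 [e eP]; set s := ereal_sup _.
apply/eqP; rewrite eq_le; apply/andP; split; last first.
  by apply: ge_ereal_sup => _ [n _ <-]; exact/cylinder_inf_le/cylinder_mkseq.
rewrite leNgt; apply/negP => st.
have s_ge n : cylinder_inf t (mkseq w n) <= s.
  by apply: ereal_sup_ubound; exists n.
(* This excludes [s] = -oo, leaving a real [s] below a real or infinite [t w]. *)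
have s0 : 0 <= s by exact: le_trans (cylinder_inf_ge0 _ t0) (s_ge 0%N).
have [a [b [c /andP[sq qt]]]] : exists a b c,
    s < (rat_of_code R a b c)%:E < t w.
  move: st s0; case: s {s_ge} => [s| |]; case: (t w) => [u| |] // su _.
    by have [a [b [c]]] := rat_of_code_dense su; exists a, b, c.
  have [a [b [c /andP[h _]]]] : exists a b c, (s < rat_of_code R a b c < s + 1)%R.
    by apply: rat_of_code_dense; rewrite ltrDl.
  by exists a, b, c; rewrite lte_fin h ltry.
have [x [n xn] xw] : (\bigcup_(x in [set x | exists n,
    computes e [tuple a; b; c; n] (str_code x)]) cylinder x) w.
  by rewrite -eP.
suff : (rat_of_code R a b c)%:E <= s by rewrite leNgt sq.
apply: le_trans (s_ge (size x)); rewrite xw.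
apply: le_ereal_inf_tmp => _ [w' xw' <-]; apply/ltW.
suff : [set w | (rat_of_code R a b c)%:E < t w] w' by [].
by rewrite eP; exists x => //; exists n.
Qed.

(** [t] is a pointwise limit of functions of finitely many bits. *)
Lemma measurable_lower_semicomputable t :
  (forall w, 0 <= t w) -> lower_semicomputable t -> measurable_fun setT t.
Proof.
move=> t0 tl.
apply: (@emeasurable_fun_cvg _ Omega R setT
  (fun n w => cylinder_inf t (mkseq w n)) t) => //.
  by move=> n; exact: measurable_fun_prefix.
move=> w _; rewrite [t w]lower_semicomputable_sup //.
exact/ereal_nondecreasing_cvgn/nondecreasing_cylinder_inf.
Qed.

End lower_semicontinuity.

(** * The upward closure of a test and its approximations *)

Section upward_closure.
Local Open Scope ereal_scope.
Variable R : realType.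
Implicit Types t : Omega -> \bar R.

Definition up_closure t (w : Omega) : \bar R :=
  ereal_sup (t @` [set w' | le_Omega w' w]).

Lemma le_up_closure t w w' : le_Omega w' w -> t w' <= up_closure t w.
Proof. by move=> ww'; apply: ereal_sup_ubound; exists w'. Qed.

Lemma le_Omega_refl w : le_Omega w w.
Proof. by move=> i. Qed.

Lemma monotone_up_closure t : monotone_Omega (up_closure t).
Proof.
move=> w w' ww'; apply: ge_ereal_sup => _ [v vw <-]; apply: le_up_closure => i.
exact: leq_trans (vw i) (ww' i).
Qed.

Lemma lower_semicomputable_up_closure t :
  lower_semicomputable t -> lower_semicomputable (up_closure t).
Proof.
move=> [e eP]; have [e' e'P] := upward_enumeration e.
exists e' => a b c; apply/seteqP; split=> w /=.
  move=> /ereal_sup_gt[_ [w' w'w <-] qt].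
  have [x xe xw'] : (\bigcup_(x in [set x | exists n,
      computes e [tuple a; b; c; n] (str_code x)]) cylinder x) w'.
    by rewrite -eP.
  (* The prefix of [w] of the same length dominates [x], which is a prefix of some [w'] below
     [w]. *)
  exists (mkseq w (size x)); last exact: cylinder_mkseq.
  by apply/e'P; exists x => //; rewrite -{1}xw'; exact: str_le_mkseq.
move=> [y /e'P[x xe xy] yw].
(* Padding [x] with zeros gives a point of [cylinder x] that is below [w]. *)
apply: lt_le_trans (le_up_closure t (le_zero_pad xy yw)).
suff : [set w | (rat_of_code R a b c)%:E < t w] (zero_pad x) by [].
by rewrite eP; exists x => //; exact: cylinder_zero_pad.
Qed.

(** Tuples make the maximum range over a finite type. The default, all zeros, is below every string
    of length n. *)
Definition best_prefix t n (x : seq bool) : n.-tuple bool :=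
  [arg max_(y > [tuple of nseq n false] | str_le y x) cylinder_inf t y]%O.

Lemma best_prefixP t n (w : Omega) :
  str_le (best_prefix t n (mkseq w n)) (mkseq w n) /\
  forall w', le_Omega w' w ->
    cylinder_inf t (mkseq w' n) <=
    cylinder_inf t (best_prefix t n (mkseq w n)).
Proof.
rewrite /best_prefix; case: arg_maxP => [|y yw ymax].
  apply/str_leP; split=> [|i]; first by rewrite size_tuple size_mkseq.
  by rewrite /= nth_nseq if_same.
split=> // w' w'w.
have /= := ymax (Tuple (introT eqP (size_mkseq w' n))); apply.
exact: str_le_mkseq.
Qed.

Definition best_below t n (w : Omega) : Omega :=
  zero_pad (best_prefix t n (mkseq w n)).

Lemma measurable_best_below t n : measurable_fun setT (best_below t n).
Proof. exact: (measurable_fun_prefix n (fun x => zero_pad (best_prefix t n x))). Qed.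

Lemma best_below_le t n w : le_Omega (best_below t n w) w.
Proof.
have [h _] := best_prefixP t n w.
exact: le_zero_pad h (cylinder_mkseq w n).
Qed.

(** The first n bits of [best_below t n w] are the maximising string, so this is the maximum of
    [cylinder_inf t] over the strings below the prefix of [w]. *)
Definition up_approx t n (w : Omega) : \bar R :=
  cylinder_inf t (mkseq (best_below t n w) n).

Lemma measurable_up_approx t n : measurable_fun setT (up_approx t n).
Proof.
exact: (measurable_fun_prefix n
  (fun x => cylinder_inf t (mkseq (zero_pad (best_prefix t n x)) n))).
Qed.

Lemma cylinder_inf_le_up_approx t n w w' :
  le_Omega w' w -> cylinder_inf t (mkseq w' n) <= up_approx t n w.
Proof.
have [_ h] := best_prefixP t n w => /h /le_trans; apply.
rewrite /up_approx (_ : mkseq (best_below t n w) n = best_prefix t n (mkseq w n)) //.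
have := cylinder_zero_pad (best_prefix t n (mkseq w n)).
by rewrite /cylinder /= size_tuple.
Qed.

(** The maximiser at level m, extended by zeros, is still below [w]: its longer prefix has a larger
    infimum and competes at level n. *)
Lemma nondecreasing_up_approx t w :
  {homo up_approx t ^~ w : m n / (m <= n)%N >-> m <= n}.
Proof.
move=> m n mn; apply: le_trans (nondecreasing_cylinder_inf t _ mn) _.
exact/cylinder_inf_le_up_approx/best_below_le.
Qed.

(** Two suprema are exchanged: [t w'] is a supremum over prefix lengths, and each prefix infimum of
    a [w'] below [w] is bounded by the approximation of that level. *)
Lemma cvg_up_approx t w : (forall w, 0 <= t w) -> lower_semicomputable t ->
  up_approx t n w @[n --> \oo] --> up_closure t w.
Proof.
move=> t0 tl; rewrite (_ : up_closure t w = ereal_sup (range (up_approx t ^~ w))).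
  exact/ereal_nondecreasing_cvgn/nondecreasing_up_approx.
apply/eqP; rewrite eq_le; apply/andP; split.
  apply: ge_ereal_sup => _ [w' w'w <-]; rewrite (lower_semicomputable_sup w') //.
  apply: ge_ereal_sup => _ [n _ <-].
  apply: le_trans (cylinder_inf_le_up_approx t n w'w) _.
  by apply: ereal_sup_ubound; exists n.
apply: ge_ereal_sup => _ [n _ <-].
apply: le_trans (le_up_closure t (best_below_le t n w)).
exact/cylinder_inf_le/cylinder_mkseq.
Qed.

End upward_closure.

(** * Couplings and comparison of integrals *)

Section coupling.
Local Open Scope ereal_scope.
Variable R : realType.

(* The coupling is the law of (phi w, w). *)
Lemma coupled_below_distribution (Q : probability Omega R)
    (phi : {mfun Omega >-> Omega}) :
  (forall w, le_Omega (phi w) w) -> coupled_below (distribution Q phi) Q.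
Proof.
move=> phi_le.
have mg : measurable_fun setT (fun w : Omega => (phi w, w)).
  by apply: measurable_fun_pair => //; exact: measurable_id.
pose g : {mfun Omega >-> (Omega * Omega)%type} := HB.pack (fun w : Omega => (phi w, w))
  (isMeasurableFun.Build _ _ _ _ _ mg).
exists (distribution Q g); split=> //.
rewrite -[RHS](@probability_setT _ _ _ Q) /distribution /pushforward.
by congr (Q _); apply/seteqP; split=> // w _; exact: phi_le.
Qed.

(** The order is a countable intersection of conditions on single coordinates, each a union of two
    measurable sets. *)
Lemma measurable_le_Omega :
  measurable [set w : Omega * Omega | le_Omega w.1 w.2].
Proof.
have mcoord i : measurable_fun setT (fun w : Omega => w i).
  rewrite (_ : (fun w : Omega => w i) =
    (fun w : Omega => nth false (mkseq w i.+1) i)).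
    exact: (measurable_fun_prefix i.+1 (fun x => nth false x i)).
  by apply/funext => w; rewrite nth_mkseq.
rewrite (_ : [set _ | _] =
    \bigcap_i [set w : Omega * Omega | (w.1 i <= w.2 i)%N]); last first.
  by apply/seteqP; split=> [w h i _|w h i]; exact: (h i).
apply: bigcapT_measurable => i.
rewrite (_ : [set _ | _] =
    fst @^-1` [set w : Omega | w i = false] `|`
    snd @^-1` [set w : Omega | w i = true]); last first.
  apply/seteqP; split=> -[w w'] /=; last by case=> ->; case: (w i).
  by case: (w i); case: (w' i) => // _; [right|left|left].
have mb b : measurable [set w : Omega | w i = b].
  rewrite -[X in measurable X]setTI.
  exact: (mcoord i measurableT [set b]).
by apply: measurableU; rewrite -[X in measurable X]setTI;
  [exact: measurable_fst|exact: measurable_snd].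
Qed.

(** Both integrals are moved to the coupling, under which [f w.1 <= f w.2] almost everywhere. *)
Lemma coupled_below_le_integral (P Q : probability Omega R) f :
  coupled_below P Q -> (forall w, 0 <= f w) -> monotone_Omega f ->
  measurable_fun setT f -> \int[P]_w f w <= \int[Q]_w f w.
Proof.
move=> [C [CP CQ Cle]] f0 f_mono mf.
have -> : \int[P]_w f w = \int[C]_w f w.1.
  rewrite -(ge0_integral_pushforward measurable_fst C (f := f) (D := setT)) //.
  by apply: eq_measure_integral => A mA _; exact/esym/CP.
have -> : \int[Q]_w f w = \int[C]_w f w.2.
  rewrite -(ge0_integral_pushforward measurable_snd C (f := f) (D := setT)) //.
  by apply: eq_measure_integral => A mA _; exact/esym/CQ.
apply: ae_ge0_le_integral => //.
- exact: measurableT_comp mf measurable_fst.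
- exact: measurableT_comp mf measurable_snd.
have mle := measurable_le_Omega.
(* The total mass of the coupling comes from its first marginal; being finite, it makes the
   complement of the order relation a null set. *)
have C1 : C setT = 1 by rewrite -(@probability_setT _ _ _ P) -CP.
have Cfin : C setT < +oo by rewrite C1 ltry.
have C0 : C (~` [set w | le_Omega w.1 w.2]) = 0.
  have := measureD measurableT mle Cfin.
  rewrite setTD setTI => ->; rewrite -[RHS](@subee _ 1) //.
  by congr (_ - _); [exact: C1|exact: Cle].
exists (~` [set w | le_Omega w.1 w.2]); split=> //; first exact: measurableC.
by move=> w /= h le_w; apply: h => _; exact: f_mono.
Qed.

End coupling.

(** * The integral bound and universality *)

Lemma integral_up_closure_le1 (R : realType) (Q : probability Omega R) t :
  class_test [set P | coupled_below P Q] t ->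
  (\int[Q]_w up_closure t w <= 1)%E.
Proof.
move=> [t0 tl tint].
have mt := measurable_lower_semicomputable t0 tl.
(* Written as a limit, the closure is integrated by monotone convergence, and it suffices to bound
   each approximation. *)
rewrite (_ : up_closure t = fun w => limn (up_approx t ^~ w)); last first.
  by apply/funext => w; apply/esym/cvg_lim => //; exact: cvg_up_approx.
have up0 n w : (0 <= up_approx t n w)%E by exact: cylinder_inf_ge0.
have cvgI := cvg_monotone_convergence (mu := Q) measurableT
  (fun n => measurable_up_approx t n) (fun n w _ => up0 n w)
  (fun w _ => @nondecreasing_up_approx _ t w).
rewrite -(cvg_lim _ cvgI) //; apply: lime_le.
  by apply/cvg_ex; eexists; exact: cvgI.
apply: nearW => n.
pose phi : {mfun Omega >-> Omega} := HB.pack (best_below t n)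
  (isMeasurableFun.Build _ _ _ _ _ (measurable_best_below t n)).
(* The law of [best_below t n] under [Q] is in the class, so [t] has integral at most 1 against
   it. *)
apply: le_trans (tint _ (coupled_below_distribution (phi := phi) _ _)); last first.
  exact: best_below_le.
rewrite ge0_integral_distribution //; apply: ge0_le_integral => //.
- exact: measurable_up_approx.
- exact: measurableT_comp mt (measurable_best_below t n).
- by move=> w _; exact/cylinder_inf_le/cylinder_mkseq.
Qed.

Theorem theorem17 (R : realType) (p : R) (p01 : 0 <= p <= 1)
    (p_computable : computable_real p) (r : Omega -> \bar R)
    (r_universal : universal (sparseness_test p) r) :
  universal (class_test (sparse_measures p)) r.
Proof.
have [[r0 r_mono rl r_int] r_max] := r_universal; split.
  split=> // P PB; apply: le_trans r_int.
  apply: coupled_below_le_integral => //.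
  exact: measurable_lower_semicomputable.
move=> t t_test; have [t0 tl _] := t_test.
have [|c c0 tc] := r_max (up_closure t).
  split.
  - by move=> w; exact: le_trans (le_up_closure t (le_Omega_refl w)).
  - exact: monotone_up_closure.
  - exact: lower_semicomputable_up_closure.
  - exact: integral_up_closure_le1.
(* [t] is below its upward closure, so the constant for the closure also serves [t]. *)
exists c => // w; apply: le_trans (tc w).
exact/le_up_closure/le_Omega_refl.
Qed.
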